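(* Let $(X,d)$ be a locally radially quasi-convex metric space. Then $(D^{\infty}(X),\|\cdot\|_{D^{\infty}})$ is a Banach space.
   Context: For a metric space $(X,d)$ and $f:X\to\mathbb{R}$, the infinitesimal Lipschitz constant of $f$ at a non-isolated point $x\in X$ is $\mathrm{Lip} f(x)=\limsup_{y\to x,\,y\neq x}\frac{|f(x)-f(y)|}{d(x,y)}\in[0,\infty]$, and $\mathrm{Lip} f(x)=0$ if $x$ is isolated. Write $\|\mathrm{Lip} f\|_\infty=\sup_{x\in X}\mathrm{Lip} f(x)$ and $\|f\|_\infty=\sup_{x\in X}|f(x)|$. $D^\infty(X)$ is the space of all bounded functions $f:X\to\mathbb{R}$ with $\|\mathrm{Lip} f\|_\infty<+\infty$, with norm $\|f\|_{D^\infty}=\max\{\|f\|_\infty,\|\mathrm{Lip} f\|_\infty\}$. The length of a continuous curve $\gamma:[a,b]\to X$ is $\ell(\gamma)=\sup\sum_{i=0}^{n-1}d(\gamma(t_i),\gamma(t_{i+1}))$ over all partitions $a=t_0<\dots<t_n=b$; $\gamma$ is rectifiable if $\ell(\gamma)<\infty$. $X$ is locally radially quasi-convex if for each $x\in X$ there exist a neighborhood $U^x$ of $x$ and a constant $K_x>0$ such that for each $y\in U^x$ there is a rectifiable curve $\gamma$ in $U^x$ connecting $x$ and $y$ with $\ell(\gamma)\le K_x d(x,y)$. *)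

(* Defs.v *)
From mathcomp Require Import all_boot all_order all_algebra.
From mathcomp Require Import all_classical all_reals all_analysis.

Set Implicit Arguments.
Unset Strict Implicit.
Unset Printing Implicit Defensive.

Import Order.TTheory GRing.Theory Num.Theory.
Import numFieldNormedType.Exports.

Local Open Scope classical_set_scope.
Local Open Scope ring_scope.

(* Curves are functions on all of R of which only the restriction to [a, b]
   matters. The list a :: s enumerates a partition a = t_0 < ... < t_n = b. *)
Definition curve_length (R : realType) (X : metricType R) (a b : R)
    (g : R -> X) : \bar R :=
  ereal_sup [set (\sum_(0 <= i < size s)
                    mdist (g (nth b (a :: s) i)) (g (nth b (a :: s) i.+1)))%:E
            | s in itv_partition a b].

Definition rectifiable (R : realType) (X : metricType R) (a b : R)
    (g : R -> X) : Prop :=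
  (curve_length a b g < +oo)%E.

Definition locally_radially_quasiconvex (R : realType) (X : metricType R) :
    Prop :=
  forall x : X, exists (U : set X) (K : R), [/\ nbhs x U, 0 < K &
    forall y, U y -> exists (a b : R) (g : R -> X),
      [/\ a < b, {within `[a, b], continuous g}, g a = x /\ g b = y,
          g @` `[a, b] `<=` U &
          rectifiable a b g /\
          (curve_length a b g <= (K * mdist x y)%:E)%E]].

Definition Lip (R : realType) (X : metricType R) (f : X -> R) (x : X) :
    \bar R :=
  if `[< isolated [set: X] x >] then 0%E
  else limf_esup (fun y : X => (`|f x - f y| / mdist x y)%:E) x^'.

(* The supremum is taken in [0, +oo], so that it is 0 (and not -oo) when X is
   empty; the functions g it is applied to are nonnegative. *)
Definition sup0 (R : realType) (X : Type) (g : X -> \bar R) : \bar R :=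
  ereal_sup (0%E |` range g).

Definition sup_norm (R : realType) (X : Type) (f : X -> R) : \bar R :=
  sup0 (fun x => `|f x|%:E).

Definition Lip_norm (R : realType) (X : metricType R) (f : X -> R) : \bar R :=
  sup0 (Lip f).

Definition Dinfty (R : realType) (X : metricType R) : set (X -> R) :=
  [set f | [bounded f x | x in [set: X]] /\ (Lip_norm f < +oo)%E].

Definition Dinfty_norm (R : realType) (X : metricType R) (f : X -> R) :
    \bar R :=
  maxe (sup_norm f) (Lip_norm f).

(* A set D of real functions, with the pointwise operations and with N as norm,
   is a Banach space: it is the carrier of a complete normed module. In
   particular D is a linear subspace, and N is finite on D and is a norm. *)
Definition is_banach_function_space (R : realType) (X : Type)
    (D : set (X -> R)) (N : (X -> R) -> \bar R) : Prop :=
  exists (V : completeNormedModType R) (phi : V -> (X -> R)),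
    [/\ set_bij [set: V] D phi,
        forall (c : R) (u v : V),
          phi (c *: u + v) = (fun x => c * phi u x + phi v x) &
        forall u : V, `|u|%:E = N (phi u)].

(* Main.v *)
From HB Require Import structures.
Require Import Defs.
From mathcomp Require Import all_boot all_order all_algebra.
From mathcomp Require Import all_classical all_reals all_analysis.
From mathcomp Require Import ring lra.

Set Implicit Arguments.
Unset Strict Implicit.
Unset Printing Implicit Defensive.

Import Order.TTheory GRing.Theory Num.Theory.
Import numFieldNormedType.Exports.

Local Open Scope classical_set_scope.
Local Open Scope ring_scope.

(** That the space of the theorem is a normed space is formal, once Lip f x <= L
    is rephrased as a local inequality between real numbers (Lip_leP). This
    turns a bound L on the norm of f into a predicate, Dinfty_le f L, which
    visibly behaves well under sums and scalings, and in which the convention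
    for isolated points has disappeared.

    Completeness rests on the geometry. If Lip h <= L at every point, then
    along a curve the increment of h is at most L times the length
    (lip_le_curve). Hence, by radial quasi-convexity, every x has a
    neighborhood U and a constant K such that
    |h x - h y| <= L * K * d(x,y) for y in U, for all such h at once
    (radially_lipschitz): a pointwise infinitesimal bound gives a local one
    that is stable under pointwise limits.

    A Cauchy filter converges uniformly to some f. Let u, v be members that
    are e-close in norm, with v moreover in a part of the filter of diameter at
    most d. Near x the function u - v has slope at most about e, while v - f,
    as a pointwise limit of differences of norm at most d, has slope at most
    K * d from x. Letting d tend to 0 for fixed x gives Lip (u - f) x <= e: the
    constant K, which depends on x, is absorbed by the choice of v, so that the
    bound is uniform in x (Dspace_cauchy_le). *)

(** * The infinitesimal Lipschitz constant as a local inequality *)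

(** The slack e absorbs the limit superior, and multiplying by the distance
    instead of dividing makes y = x harmless. *)
Definition lip_le (R : realType) (X : metricType R) (f : X -> R) (x : X)
    (L : R) : Prop :=
  forall e, 0 < e -> \forall y \near x, `|f x - f y| <= (L + e) * mdist x y.

Section PointwiseLipschitz.
Variables (R : realType) (X : metricType R).
Implicit Types (f g : X -> R) (x : X) (L M c : R).

(** At an isolated point the right-hand side always holds, since y = x is the
    only nearby point; for L >= 0 this matches the value 0 given to Lip there. *)
Lemma Lip_leP f x L : 0 <= L -> (Lip f x <= L%:E)%E <-> lip_le f x L.
Proof.
move=> L0; rewrite /Lip; case: asboolP => [[_ [V Vx Vs]]|niso].
  split => [_ e e0|_]; last by rewrite lee_fin.
  apply: filterS Vx => y Vy; have : (V `&` setT) y by split.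
  by rewrite Vs => ->; rewrite subrr normr0 mdistxx mulr0.
split=> [fL e e0|fL].
(* The bound L + e is strict for the infimum, so one punctured neighborhood
   achieves it. *)
- have /ereal_inf_lt [_ [A xA <-] supA] :
      (limf_esup (fun y => (`|f x - f y| / mdist x y)%:E) x^' < (L + e)%:E)%E.
    by rewrite (le_lt_trans fL)// lte_fin ltrDl.
  move: xA; rewrite /dnbhs /within /= => xA; apply: filterS xA => y Ay.
  have [<-|xy] := eqVneq x y; first by rewrite subrr normr0 mdistxx mulr0.
  rewrite -ler_pdivrMr ?mdist_gt0// -lee_fin.
  apply: le_trans (ltW supA); apply: ereal_sup_ubound; exists y => //.
  by apply: Ay; rewrite eq_sym.
- apply/lee_addgt0Pr => e e0.
  set B := [set y | y != x /\ `|f x - f y| <= (L + e) * mdist x y].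
  apply: (@le_trans _ _ (ereal_sup
     ((fun y => (`|f x - f y| / mdist x y)%:E) @` B))).
    apply: ereal_inf_lbound; exists B => //.
    rewrite /dnbhs /within /=; apply: filterS (fL _ e0) => y fy yx.
    by split.
  apply: ge_ereal_sup => _ [y [yx fy] <-].
  by rewrite -EFinD lee_fin ler_pdivrMr// mdist_gt0 eq_sym.
Qed.

Lemma lip_leD f g x L M : lip_le f x L -> lip_le g x M ->
  lip_le (fun y => f y + g y) x (L + M).
Proof.
move=> fL gM e e0; have e20 : 0 < e / 2 by rewrite divr_gt0.
apply: filterS2 (fL _ e20) (gM _ e20) => y fy gy.
rewrite (_ : _ - _ = (f x - f y) + (g x - g y)); last by ring.
rewrite (le_trans (ler_normD _ _))// (le_trans (lerD fy gy))//.
by rewrite le_eqVlt; apply/orP; left; apply/eqP; field.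
Qed.

Lemma lip_leZ c f x L : lip_le f x L ->
  lip_le (fun y => c * f y) x (`|c| * L).
Proof.
(* The quotient e / (`|c| + 1) serves for c = 0 too. *)
move=> fL e e0; have c1 : 0 < `|c| + 1 by rewrite ltr_wpDl.
apply: filterS (fL _ (divr_gt0 e0 c1)) => y fy.
rewrite -mulrBr normrM (le_trans (ler_wpM2l _ fy))// mulrA.
rewrite ler_wpM2r ?mdist_ge0// mulrDr lerD2l mulrA ler_pdivrMr//.
rewrite mulrC ler_pM2l//; lra.
Qed.

Lemma lip_leW f x L M : L <= M -> lip_le f x L -> lip_le f x M.
Proof.
move=> LM fL e e0; apply: filterS (fL _ e0) => y /le_trans; apply.
by rewrite ler_wpM2r ?mdist_ge0// lerD2r.
Qed.

End PointwiseLipschitz.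

(** * Mean value inequality along curves *)

Section Curves.
Variables (R : realType) (X : metricType R).

(** The set of t for which the increment of h over [a, t] is controlled by a
    partition of [a, t] contains a. Its supremum c belongs to it, because the
    local estimate at c reaches back to some member of the set; and c = b,
    because otherwise the same estimate would extend a partition beyond c.
    Only estimates from a fixed t are available, since the neighborhood in
    lip_le depends on the point: this is why the partition is grown from one
    point to the next. Estimating against partition sums, rather than against
    the length of the restriction of g to [a, t], avoids the additivity of
    length. *)
Lemma itv_partition_le_chain (g : R -> X) (h : R -> R) (a b L : R) :
  a <= b ->
  (forall t, t \in `[a, b] -> \forall s \near within `[a, b] (nbhs t),
     `|h t - h s| <= L * mdist (g t) (g s)) ->
  exists2 s, itv_partition a b s &
    `|h a - h b| <= L * \sum_(0 <= i < size s)
      mdist (g (nth b (a :: s) i)) (g (nth b (a :: s) i.+1)).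
Proof.
move=> ab hloc.
(* The default value b of nth does not change with t: all indices in the sum
   are in range, so P b is the goal. *)
pose P t := exists2 s, itv_partition a t s &
    `|h a - h t| <= L * \sum_(0 <= i < size s)
      mdist (g (nth b (a :: s) i)) (g (nth b (a :: s) i.+1)).
have Pext t t' : t < t' -> P t -> `|h t - h t'| <= L * mdist (g t) (g t') ->
    P t'.
  move=> tt' [s st hs] htt'; exists (rcons s t').
    by rewrite -cats1; apply: itv_partition_cat st _; exact: itv_partition1.
  rewrite size_rcons big_nat_recr//= mulrDr -rcons_cons !nth_rcons/= ltnSn.
  rewrite ltnn eqxx.
  have -> : nth b (a :: s) (size s) = t.
    by rewrite -[size s]/((size (a :: s)).-1) nth_last; case: st => _ /eqP.
  rewrite (_ : h a - h t' = (h a - h t) + (h t - h t')); last by ring.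
  rewrite (le_trans (ler_normD _ _))// lerD// (le_trans hs)//.
  rewrite le_eqVlt; apply/orP; left; apply/eqP; congr (_ * _).
  apply: eq_big_nat => i /andP[_ ilt].
  by rewrite -rcons_cons !nth_rcons/= ilt ltnS (ltnW ilt).
have hlocP t : a <= t <= b -> exists2 e, 0 < e & forall s, a <= s <= b ->
    `|t - s| < e -> `|h t - h s| <= L * mdist (g t) (g s).
  move=> tab; have := hloc t; rewrite in_itv/= => /(_ tab).
  rewrite near_withinE => /nbhs_ballP[e/= e0 he]; exists e => // s sab ts.
  by apply: he => //=; rewrite in_itv.
pose S := [set t | a <= t <= b /\ P t].
have Sa : S a.
  split; first by rewrite lexx.
  by exists [::]; rewrite /itv_partition//= subrr normr0 big_nil mulr0.
have supS : has_sup S by split; [exists a|exists b => t [/andP[]]].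
set c := sup S.
have ubS t : S t -> t <= c by move=> St; apply: sup_upper_bound.
have cab : a <= c <= b.
  by rewrite ubS//=; apply: ge_sup; [exists a|move=> t [/andP[]]].
have [e e0 he] := hlocP c cab.
have Pc : P c.
  have [t St ct] := sup_adherent e0 supS.
  have := ubS _ St; rewrite le_eqVlt => /orP[/eqP <-|tc]; first by case: St.
  case: St => tab Pt; apply: (Pext t) => //.
  rewrite distrC metric_sym; apply: he => //.
  rewrite gtr0_norm ?subr_gt0//; rewrite -/c in ct; lra.
suff cb : c = b by move: Pc; rewrite cb.
apply/eqP; rewrite eq_le; case/andP: (cab) => ac -> /=.
rewrite leNgt; apply/negP => cb.
pose t := Num.min b (c + e / 2).
have ct : c < t by rewrite lt_min cb ltrDl divr_gt0.
have tb : t <= b by rewrite ge_min lexx.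
have te : t <= c + e / 2 by rewrite ge_min lexx orbT.
have tab : a <= t <= b by rewrite tb andbT; lra.
suff : t <= c by rewrite leNgt ct.
apply: ubS; split => //; apply: (Pext c) => //; apply: he => //.
rewrite ltr0_norm ?subr_lt0//; lra.
Qed.

(** The local estimate has slope L + e' at each point of the curve, for any
    e' > 0, and partition sums are at most the length. *)
Lemma lip_le_curve (f : X -> R) (L l a b : R) (g : R -> X) :
  0 <= L -> 0 <= l -> (forall z, lip_le f z L) ->
  a <= b -> {within `[a, b], continuous g} ->
  (curve_length a b g <= l%:E)%E -> `|f (g a) - f (g b)| <= L * l.
Proof.
move=> L0 l0 fL ab gc gl; apply/ler_addgt0Pl => e e0.
have l1 : 0 < l + 1 by rewrite ltr_wpDl.
have e'0 : 0 < e / (l + 1) by rewrite divr_gt0.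
have [|s sab fs] := @itv_partition_le_chain g (f \o g) a b (L + e / (l + 1)) ab.
  move=> t tab; have /subspace_continuousP /(_ t tab) gt := gc.
  exact: gt (fL (g t) _ e'0).
apply: (le_trans fs).
apply: (@le_trans _ _ ((L + e / (l + 1)) * l)).
  rewrite ler_wpM2l ?addr_ge0// ?(ltW e'0)// -lee_fin.
  by apply: le_trans gl; apply: ereal_sup_ubound; exists s.
rewrite mulrDl addrC lerD2r mulrAC ler_pdivrMr// ler_pM2l//; lra.
Qed.

(** U and K depend on x only, not on f: this uniformity over all functions with
    bounded infinitesimal Lipschitz constant is what survives a limit. *)
Lemma radially_lipschitz (hX : locally_radially_quasiconvex X) (x : X) :
  exists (U : set X) (K : R), [/\ nbhs x U, 0 < K &
    forall (f : X -> R) (L : R), 0 <= L -> (forall z, lip_le f z L) ->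
    forall y, U y -> `|f x - f y| <= L * (K * mdist x y)].
Proof.
have [U [K [Ux K0 UK]]] := hX x; exists U, K; split => // f L L0 fL y Uy.
have [a [b [g [ab gc [<- <-] _ [_ gl]]]]] := UK _ Uy.
apply: lip_le_curve fL (ltW ab) gc gl => //.
by rewrite mulr_ge0 ?mdist_ge0// ltW.
Qed.

End Curves.

(** * Bounds on the norm *)

Definition Dinfty_le (R : realType) (X : metricType R) (f : X -> R) (L : R) :
    Prop :=
  (forall x, `|f x| <= L) /\ (forall x, lip_le f x L).

Section DinftyNorm.
Variables (R : realType) (X : metricType R).
Implicit Types (f g : X -> R) (L M c : R).

Lemma sup0_leP (T : Type) (h : T -> \bar R) L : 0 <= L ->
  (Defs.sup0 h <= L%:E)%E <-> forall x, (h x <= L%:E)%E.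
Proof.
move=> L0; split=> [hL x|hL].
  by apply: le_trans hL; apply: ereal_sup_ubound; right; exists x.
by apply: ge_ereal_sup => _ [->|[x _ <-]//]; rewrite lee_fin.
Qed.

Lemma Dinfty_norm_leP f L : 0 <= L ->
  (Dinfty_norm f <= L%:E)%E <-> Dinfty_le f L.
Proof.
move=> L0; rewrite /Dinfty_norm ge_max; split.
  move=> /andP[/(sup0_leP _ L0) bf /(sup0_leP _ L0) lf].
  by split=> x; [rewrite -lee_fin; exact: bf|exact/Lip_leP].
move=> [bf lf]; apply/andP; split; apply/sup0_leP => // x.
by apply/Lip_leP.
Qed.

Lemma Dinfty_norm_ge0 f : (0 <= Dinfty_norm f)%E.
Proof. by rewrite le_max; apply/orP; left; apply: ereal_sup_ubound; left. Qed.

Lemma Dinfty_leD f g L M : Dinfty_le f L -> Dinfty_le g M ->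
  Dinfty_le (fun x => f x + g x) (L + M).
Proof.
move=> [bf lf] [bg lg]; split=> x; last exact: lip_leD.
by rewrite (le_trans (ler_normD _ _))// lerD.
Qed.

Lemma Dinfty_leZ f L c : Dinfty_le f L ->
  Dinfty_le (fun x => c * f x) (`|c| * L).
Proof.
move=> [bf lf]; split=> x; last exact: lip_leZ.
by rewrite normrM ler_wpM2l.
Qed.

Lemma Dinfty_le0 : Dinfty_le (fun _ : X => 0 : R) 0.
Proof.
split=> [x|x e e0]; first by rewrite normr0.
by apply: nearW => y; rewrite subrr normr0 add0r mulr_ge0 ?mdist_ge0 ?ltW.
Qed.

Lemma DinftyP f : Dinfty f <-> exists2 L, 0 <= L & Dinfty_le f L.
Proof.
split=> [[/(@filter_ex _ (pinfty_nbhs R))[M bf] lf]|[L L0 [bf lf]]].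
  have [L L0 fL] : exists2 L, 0 <= L & (Lip_norm f <= L%:E)%E.
    have f0 : (0 <= Lip_norm f)%E by apply: ereal_sup_ubound; left.
    exists (fine (Lip_norm f)); first exact: fine_ge0.
    by rewrite fineK// ge0_fin_numE.
  exists (`|M| + L); first by rewrite addr_ge0.
  split=> x.
    by rewrite (le_trans (bf x I))// (le_trans (ler_norm M))// lerDl.
  apply: (@lip_leW _ _ _ _ L); first by rewrite lerDr.
  by apply/Lip_leP => //; move/(sup0_leP _ L0) : fL; exact.
split.
  exists L; split; first exact: num_real.
  by move=> M LM x _; exact: le_trans (bf x) (ltW LM).
apply: (@le_lt_trans _ _ L%:E); last exact: ltry.
by apply/sup0_leP => // x; exact/Lip_leP.
Qed.

End DinftyNorm.

(** * The normed module *)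

Section Dspace.
Variables (R : realType) (X : metricType R).

(** The codomain is R^o so that functions form a module over R. *)
Definition Dinfty_pred : {pred X -> R^o} := [pred f | `[< @Dinfty R X f >]].

Lemma Dinfty_submod_closed : submod_closed Dinfty_pred.
Proof.
split=> [|c f g /asboolP/DinftyP[L L0 fL] /asboolP/DinftyP[M M0 gM]].
  by apply/asboolP/DinftyP; exists 0 => //; exact: Dinfty_le0.
apply/asboolP/DinftyP; exists (`|c| * L + M).
  by rewrite addr_ge0// mulr_ge0.
exact: Dinfty_leD (Dinfty_leZ c fL) gM.
Qed.

HB.instance Definition _ := GRing.isSubmodClosed.Build _ _ Dinfty_pred
  Dinfty_submod_closed.

Record Dspace := MkDspace
  { Dfun : X -> R^o; DfunP : Dfun \in Dinfty_pred }.

HB.instance Definition _ := [isSub for Dfun].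
HB.instance Definition _ := [Choice of Dspace by <:].
HB.instance Definition _ := [SubChoice_isSubLmodule of Dspace by <:].

Implicit Types (u v : Dspace) (L c : R).

Definition Dnorm u : R := fine (Dinfty_norm (Dfun u : X -> R)).

Lemma EFin_Dnorm u : (Dnorm u)%:E = Dinfty_norm (Dfun u : X -> R).
Proof.
have /asboolP/DinftyP[L L0 /(Dinfty_norm_leP _ L0) uL] := DfunP u.
rewrite /Dnorm fineK// fin_numElt (lt_le_trans _ (Dinfty_norm_ge0 _))//=.
by rewrite (le_lt_trans uL)// ltry.
Qed.

Lemma Dnorm_ge0 u : 0 <= Dnorm u.
Proof. by rewrite -lee_fin EFin_Dnorm Dinfty_norm_ge0. Qed.

Lemma Dnorm_leP u L : 0 <= L -> Dnorm u <= L <-> Dinfty_le (Dfun u) L.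
Proof. by move=> L0; rewrite -lee_fin EFin_Dnorm; exact: Dinfty_norm_leP. Qed.

Lemma Dinfty_le_Dnorm u : Dinfty_le (Dfun u) (Dnorm u).
Proof. by apply/Dnorm_leP => //; exact: Dnorm_ge0. Qed.

Lemma DnormD u v : Dnorm (u + v) <= Dnorm u + Dnorm v.
Proof.
apply/Dnorm_leP; first by rewrite addr_ge0 ?Dnorm_ge0.
exact: Dinfty_leD (Dinfty_le_Dnorm u) (Dinfty_le_Dnorm v).
Qed.

Lemma DnormZ_le c u : Dnorm (c *: u) <= `|c| * Dnorm u.
Proof.
apply/Dnorm_leP; first by rewrite mulr_ge0 ?Dnorm_ge0.
exact: Dinfty_leZ (Dinfty_le_Dnorm u).
Qed.

(** The reverse of DnormZ_le is DnormZ_le for the scalar c^-1. *)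
Lemma DnormZ c u : Dnorm (c *: u) = `|c| * Dnorm u.
Proof.
apply/eqP; rewrite eq_le DnormZ_le/=.
have [->|c0] := eqVneq c 0; first by rewrite normr0 mul0r Dnorm_ge0.
have := DnormZ_le c^-1 (c *: u).
by rewrite scalerA mulVf// scale1r normfV ler_pdivlMl ?normr_gt0.
Qed.

Lemma Dnorm_eq0 u : Dnorm u = 0 -> u = 0.
Proof.
move=> u0; have [bu _] := Dinfty_le_Dnorm u; apply/val_inj/funext => x /=.
by apply/eqP; rewrite -normr_le0 -u0; exact: bu.
Qed.

HB.instance Definition _ :=
  Lmodule_isNormed.Build R Dspace DnormD DnormZ Dnorm_eq0.

Lemma Dspace_norm_leP u L : 0 <= L -> `|u| <= L <-> Dinfty_le (Dfun u) L.
Proof. exact: Dnorm_leP. Qed.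

(** * Completeness *)

(** Membership of u in a part A of diameter e bounds the distance from u to the
    pointwise limit f by e, in the full norm. The intermediate v is chosen in
    A, to be e-close to u, and in a part B so small that the factor K given by
    radially_lipschitz at x becomes negligible. *)
Lemma Dspace_cauchy_le (hX : locally_radially_quasiconvex X)
    (F : set_system Dspace) (f : X -> R) (A : set Dspace) (e : R) :
  ProperFilter F ->
  (forall d : R, 0 < d ->
    exists2 B, F B & forall u v, B u -> B v -> `|u - v| <= d) ->
  (forall x (d : R), 0 < d -> \forall u \near F, `|Dfun u x - f x| <= d) ->
  0 <= e -> F A -> (forall u v, A u -> A v -> `|u - v| <= e) ->
  forall u, A u -> Dinfty_le (fun x => Dfun u x - f x) e.
Proof.
move=> FF Fcauchy Ff e0 FA Ae u Au; split=> [x|x e' e'0].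
  apply/ler_addgt0Pr => d d0.
  have [v [Av vd]] := @filter_ex _ F FF _ (filterI FA (Ff x _ d0)).
  have /(Dspace_norm_leP _ e0) [uv _] := Ae _ _ Au Av.
  rewrite (_ : _ - _ = (Dfun u x - Dfun v x) + (Dfun v x - f x)); last by ring.
  by rewrite (le_trans (ler_normD _ _))// lerD//; exact: uv.
have [U [K [Ux K0 UK]]] := radially_lipschitz hX x.
(* With this d the slope K * d of v - f from x is at most e' / 2. *)
pose d := e' / 2 / K.
have d0 : 0 < d by rewrite !divr_gt0.
have [B FB Bd] := Fcauchy _ d0.
have [v [Av Bv]] := @filter_ex _ F FF _ (filterI FA FB).
have vf y : U y ->
    `|(Dfun v x - f x) - (Dfun v y - f y)| <= e' / 2 * mdist x y.
  move=> Uy; apply/ler_addgt0Pr => r r0.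
  have r20 : 0 < r / 2 by rewrite divr_gt0.
  have [w [Bw [wx wy]]] :=
    @filter_ex _ F FF _ (filterI FB (filterI (Ff x _ r20) (Ff y _ r20))).
  have /(Dspace_norm_leP _ (ltW d0)) [_ vw] := Bd _ _ Bv Bw.
  have := UK _ _ (ltW d0) vw _ Uy.
  rewrite mulrA /d divfK ?gt_eqF//= => vwxy.
  rewrite (_ : _ - _ = ((Dfun v x - Dfun w x) - (Dfun v y - Dfun w y)) +
    ((Dfun w x - f x) - (Dfun w y - f y))); last by ring.
  rewrite (le_trans (ler_normD _ _))// lerD// [leRHS]splitr.
  by rewrite (le_trans (ler_normB _ _))// lerD.
have e'20 : 0 < e' / 2 by rewrite divr_gt0.
have /(Dspace_norm_leP _ e0) [_ /(_ x _ e'20) uv] := Ae _ _ Au Av.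
apply: filterS2 Ux uv => y /vf {}vf /= uv.
rewrite (_ : _ - _ = ((Dfun u x - Dfun v x) - (Dfun u y - Dfun v y)) +
    ((Dfun v x - f x) - (Dfun v y - f y))); last by ring.
rewrite (le_trans (ler_normD _ _))// (le_trans (lerD uv vf))//.
by rewrite -mulrDl -addrA -splitr.
Qed.

(** The pointwise limit f lies in the space because it differs from a member u
    of the filter by a function with finite bound. *)
Lemma Dspace_complete (hX : locally_radially_quasiconvex X)
  (F : set_system Dspace) : ProperFilter F -> cauchy F -> cvg F.
Proof.
move=> FF Fc.
have Fcauchy (e : R) : 0 < e ->
    exists2 A, F A & forall u v, A u -> A v -> `|u - v| <= e.
  move=> e0; have [|w Fw] := (cauchyP F).1 Fc (e / 2).
    by rewrite divr_gt0.
  exists (ball w (e / 2)) => // u v.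
  rewrite -ball_normE /= => wu wv; rewrite [leRHS]splitr.
  by rewrite (le_trans (ler_distD w _ _))// lerD// ltW// distrC.
have ptcvg x : cvg ((fun u => Dfun u x : R) @ F).
  apply: R_complete; apply: cauchy_exP => e e0.
  have [|A FA Ae] := Fcauchy (e / 2); first by rewrite divr_gt0.
  have [u Au] := @filter_ex _ F FF _ FA.
  exists (Dfun u x : R); apply: (@filterS _ F _ A) FA => v Av /=.
  have /Dspace_norm_leP [|/(_ x) uv _] := Ae _ _ Au Av.
    by rewrite divr_ge0 ?ltW.
  rewrite /ball/= (le_lt_trans uv)// ltr_pdivrMr// ltr_pMr//; lra.
pose f x : R := lim ((fun u => Dfun u x : R) @ F).
have Ff x (e : R) : 0 < e -> \forall u \near F, `|Dfun u x - f x| <= e.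
  move=> e0; have F' : Filter F := @filter_filter _ F FF.
  have fxe := @cvgr_dist_le _ _ _ F F' _ _ (ptcvg x) e e0.
  apply: filterS fxe => u /=.
  by rewrite distrC.
have Df : (f : X -> R^o) \in Dinfty_pred.
  have [A FA A1] := Fcauchy 1 ltr01.
  have [u Au] := @filter_ex _ F FF _ FA.
  have uf := Dspace_cauchy_le hX FF Fcauchy Ff ler01 FA A1 Au.
  apply/asboolP/DinftyP; exists (Dnorm u + `|-1| * 1).
    by rewrite addr_ge0 ?Dnorm_ge0// mulr_ge0.
  have fE : f = fun x => (Dfun u x : R) + (-1) * ((Dfun u x : R) - f x).
    by apply/funext => x; ring.
  rewrite fE.
  exact: Dinfty_leD (Dinfty_le_Dnorm u) (Dinfty_leZ (-1) uf).
apply/cvg_ex; exists (MkDspace Df); apply/cvgrPdist_le => e e0.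
have [A FA Ae] := Fcauchy e e0; apply: (@filterS _ F _ A _ _ FA) => u Au.
rewrite distrC; apply/Dspace_norm_leP; first exact: ltW.
exact: (Dspace_cauchy_le hX FF Fcauchy Ff (ltW e0) FA Ae Au).
Qed.

End Dspace.

Theorem theorem3p2 (R : realType) (X : metricType R)
    (hX : locally_radially_quasiconvex X) :
  is_banach_function_space (@Dinfty R X) (@Dinfty_norm R X).
Proof.
(* Completeness depends on hX, so this structure cannot be a global instance on
   Dspace X. *)
pose V : completeNormedModType R := HB.pack (Dspace X)
  (Uniform_isComplete.Build (Dspace X) (Dspace_complete hX)).
exists V, (@Dfun R X); split=> [|//|u]; last exact: EFin_Dnorm.
split=> [u _|u v _ _ uv|f Df].
- exact/asboolP/(DfunP u).
- exact: val_inj uv.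
- by exists (MkDspace (asboolT Df)).
Qed.
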